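(* Let $X$ be a real Banach space, let $K\subset X$ be a normal cone with normal constant $c>0$, let $D\subset X$ be an open bounded set with $0\in D$ and let $y\in X$ be fixed. Assume that $T:\overline{D}_{K_y}\to K$ is a mapping (not necessarily continuous) such that $T\,\overline{D}_{K_y}$ is relatively compact and \[\inf\{\|v\|: v\in\mathbb{T}x,\ x\in\partial D_{K_y}\}>0,\] where $\mathbb{T}$ is the closed-convex envelope of $T$. If there exists a number \[\bar\lambda>\frac{c\,\sup_{x\in\partial D}\|x\|}{\inf\{\|v\|: v\in\mathbb{T}x,\ x\in\partial D_{K_y}\}}\] such that for each $\lambda\in(0,\bar\lambda]$ the operator $T_{(y,\lambda)}:=y+\lambda T$ satisfies \[\{x\}\cap \mathbb{T}_{(y,\lambda)}(x)\subset\{T_{(y,\lambda)}(x)\}\quad\text{for every } x\in\overline{D}_{K_y}\] (with $\mathbb{T}_{(y,\lambda)}$ the closed-convex envelope of $T_{(y,\lambda)}$), then there exist $x^*\in\partial D_{K_y}$ and $\lambda^*\in(0,\bar\lambda)$ such that $x^*=y+\lambda^*\,T(x^* )$.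
   Context: A cone is a closed convex set $K\subset X$ with $\mu x\in K$ for all $x\in K,\mu\ge0$, and $K\cap(-K)=\{0\}$; it induces the order $u\preceq v\iff v-u\in K$. $K$ is normal with constant $c>0$ if $\|u\|\le c\|v\|$ whenever $0\preceq u\preceq v$. For $y\in X$, $K_y:=y+K$; $D_{K_y}:=(y+D)\cap K_y$, and $\overline{D}_{K_y}$, $\partial D_{K_y}$ denote its closure and boundary relative to $K_y$; $\partial D$ is the boundary of $D$ in $X$. For a closed convex $C$, relatively open $U\subset C$ and a map $S:\overline U\to C$, the closed-convex envelope is $\mathbb{S}:\overline U\to 2^X$, $\mathbb{S}x=\bigcap_{\varepsilon>0}\overline{\mathrm{co}}\,S(\overline B_\varepsilon(x)\cap\overline U)$ ($\overline B_\varepsilon(x)$ closed ball, $\overline{\mathrm{co}}$ closed convex hull). *)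

(* Defs.v *)
From HB Require Import structures.
From mathcomp Require Import all_boot all_order all_algebra.
From mathcomp Require Import all_classical all_reals all_analysis.
Set Implicit Arguments. Unset Strict Implicit. Unset Printing Implicit Defensive.
Import Order.TTheory GRing.Theory Num.Theory.
Import numFieldNormedType.Exports.
Local Open Scope classical_set_scope.
Local Open Scope ring_scope.

Section Defs.
Context {R : realType} {X : normedModType R}.

Definition is_convex (C : set X) : Prop :=
  forall a b (t : R), 0 <= t -> t <= 1 -> C a -> C b -> C (t *: a + (1 - t) *: b).

Definition is_cone (K : set X) : Prop :=
  [/\ closed K, is_convex K,
      (forall x (mu : R), K x -> 0 <= mu -> K (mu *: x)) &
      (forall x, K x -> K (- x) -> x = 0)].

Definition cone_le (K : set X) (u v : X) : Prop := K (v - u).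

Definition normal_cone (K : set X) (c : R) : Prop :=
  0 < c /\ forall u v, cone_le K 0 u -> cone_le K u v -> `|u| <= c * `|v|.

Definition translate (y : X) (A : set X) : set X := [set y + a | a in A].

Definition rel_closure (C S : set X) : set X :=
  [set x | C x /\ forall e : R, 0 < e -> exists z, [/\ C z, S z & `|x - z| < e]].
Definition rel_boundary (C S : set X) : set X :=
  rel_closure C S `&` rel_closure C (C `\` S).

Definition boundary (S : set X) : set X := closure S `&` closure (~` S).

Definition cball (x : X) (e : R) : set X := [set z | `|z - x| <= e].

Definition clconv (A : set X) : set X :=
  [set z | forall C : set X, closed C -> is_convex C -> A `<=` C -> C z].

Definition ccenv (Ubar : set X) (S : X -> X) (x : X) : set X :=
  [set v | forall e : R, 0 < e -> clconv (S @` (cball x e `&` Ubar)) v].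

End Defs.

(* Main.v *)
Require Import Defs.
From HB Require Import structures.
From mathcomp Require Import all_boot all_order all_algebra.
From mathcomp Require Import finmap ring lra.
From mathcomp Require Import all_classical all_reals all_analysis.
Import Order.TTheory GRing.Theory Num.Theory.
Import numFieldNormedType.Exports.
Set Implicit Arguments. Unset Strict Implicit. Unset Printing Implicit Defensive.

(** It suffices to find [z] in [K] with [y + z] on the relative boundary,
    [z = tau *: a] and [a] in the envelope of [T] at [y + z]: then
    [tau = |z| / |a|] is at most [c * sup / m] (normality gives [1 <= c]), so the
    hypothesis on fixed points of the envelope of [y + tau T] applies.

    Boundary values of [T] lie in a compact set [V] of vectors of [K] of norm at
    least [m], and normality keeps the convex hull of [V] away from [0]; hence a
    vector of the cone over [V] leaves [D] when its weight [tau] is large.  Over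
    the cone spanned by a finite net of [V], with a slack coordinate that turns
    the weight into a simplex coordinate, colour a point by the slack index if it
    is outside [D], and otherwise by an index whose weight does not exceed the one
    prescribed by an averaged approximation of [T].  Scarf's combinatorial lemma,
    which constrains the colouring nowhere, produces a point in both closures that
    is an approximate eigenvector; letting the mesh tend to [0] and using that the
    closed convex hull of a compact set is compact gives [z]. *)

(** * Scarf's lemma *)

Section Combinatorics.
Import mathcomp.boot.fintype mathcomp.boot.finset.

Section Scarf.
Variables (X I : finType) (rk : I -> X -> nat) (e : I -> X) (c : X -> I).
Hypothesis rk_inj : forall i, injective (rk i).
Hypothesis rk_bot : forall i x, rk i (e i) <= rk i x.
Hypothesis rk_top :
  forall i j x, j != i -> (forall k, x != e k) -> rk i x < rk i (e j).
Hypothesis colour_slack : forall i, c (e i) = i.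

(* The slack elements [e i] stand for the missing indices: a set of size [#|I|]
   plays the role of a pair (set of ordinary elements, set of indices). *)
Definition dominant (s : {set X}) :=
  [forall y, exists i, forall x in s, rk i y <= rk i x].

Lemma dominantP (s : {set X}) :
  reflect (forall y, exists i, forall x, x \in s -> rk i y <= rk i x)
          (dominant s).
Proof.
apply: (iffP forallP) => H y.
  by have /existsP[i /forall_inP Hi] := H y; exists i.
by apply/existsP; have [i Hi] := H y; exists i; apply/forall_inP.
Qed.

Lemma dominantS (s t : {set X}) : t \subset s -> dominant s -> dominant t.
Proof.
move=> ts /dominantP ds; apply/dominantP => y; have [i Hi] := ds y.
by exists i => x xt; apply: Hi; apply: (subsetP ts).
Qed.

Lemma slack_inj : injective e.
Proof. by move=> i j /(congr1 c); rewrite !colour_slack. Qed.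

Variable x0 : X.
Hypothesis x0N : forall k, x0 != e k.
Variable i0 : I.

(** As in parity proofs of Sperner's lemma, a door is one element short of a room and carries every
    colour except [i0], each exactly once. *)
Let room (s : {set X}) := (#|s| == #|I|) && dominant s.
Let door (t : {set X}) :=
  [&& #|t|.+1 == #|I|, dominant t & c @: t == [set~ i0]].

Lemma supersets_card1 (P : pred {set X}) (t : {set X}) n : #|t|.+1 = n ->
  #|[set s : {set X} | [&& #|s| == n, P s & t \subset s]]|
    = #|[set x | (x \notin t) && P (x |: t)]|.
Proof.
move=> tn.
rewrite -(@card_in_imset _ _ (fun x => x |: t)
            [set x | (x \notin t) && P (x |: t)]); last first.
  move=> x z; rewrite !inE => /andP[xt _] /andP[zt _] /setP/(_ x).
  by rewrite !inE eqxx (negbTE xt) /= orbF => /esym/eqP.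
apply: eq_card => s; rewrite inE; apply/idP/imsetP.
  move=> /and3P[/eqP sn Ps ts].
  have : #|s :\: t| == 1 by rewrite cardsD (setIidPr ts) sn -tn subSnn.
  case/cards1P => x sx; have xs : x \in s :\: t by rewrite sx set11.
  have sE : s = x |: t.
    by rewrite -sx setUC -[LHS](setID s t) (setIidPr ts).
  exists x => //; rewrite inE -sE Ps andbT.
  by move: xs; rewrite inE => /andP[].
move=> [x]; rewrite inE => /andP[xt Pxt] ->.
by rewrite Pxt subsetUr cardsU1 xt /= add1n tn eqxx.
Qed.

Lemma subsets_card1 (P : pred {set X}) (s : {set X}) n : #|s| = n ->
  #|[set t : {set X} | [&& #|t|.+1 == n, P t & t \subset s]]|
    = #|[set x in s | P (s :\ x)]|.
Proof.
move=> sn.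
rewrite -(@card_in_imset _ _ (fun x => s :\ x)
            [set x in s | P (s :\ x)]); last first.
  move=> x z; rewrite !inE => /andP[xs _] /andP[zs _] /setP/(_ x).
  by rewrite !inE eqxx xs /= andbT => /esym/negbFE/eqP.
apply: eq_card => t; rewrite inE; apply/idP/imsetP.
  move=> /and3P[/eqP tn Pt ts].
  have : #|s :\: t| == 1 by rewrite cardsD (setIidPr ts) sn -tn subSnn.
  case/cards1P => x sx; have xs : x \in s :\: t by rewrite sx set11.
  have tE : t = s :\ x.
    by rewrite -sx setDDr setDv set0U (setIidPr ts).
  by exists x => //; rewrite inE -tE Pt andbT; move: xs; rewrite inE => /andP[].
move=> [x]; rewrite inE => /andP[xs Pxs] ->.
by rewrite Pxs subsetDl -sn (cardsD1 x s) xs eqxx.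
Qed.

(** If removing [x] leaves a door colouring, then [c] is injective on the rest and the colour of [x]
    is repeated by exactly one [x']. The only removals that work are those of [x] and [x']. *)
Lemma even_doors_of_room (s : {set X}) : #|s| = #|I| -> c @: s != [set: I] ->
  ~~ odd #|[set x in s | c @: (s :\ x) == [set~ i0]]|.
Proof.
move=> sI cs; set A := [set x in s | _].
have [->|[x xA]] := set_0Vmem A; first by rewrite cards0.
move: (xA); rewrite inE => /andP[xs /eqP cx].
have cardsx : #|c @: (s :\ x)| = #|s :\ x|.
  by apply/eqP; rewrite cx cardsC1 -sI (cardsD1 x s) xs.
have cinj : {in s :\ x &, injective c} by apply/imset_injP/eqP.
have cxN : c x != i0.
  apply: contraNneq cs => cxE; apply/eqP/setP => i; rewrite [RHS]inE.
  apply/imsetP; have [->|ni] := eqVneq i i0; first by exists x.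
  have : i \in c @: (s :\ x) by rewrite cx !inE.
  by case/imsetP => z /setD1P[_ zs] ->; exists z.
have : c x \in c @: (s :\ x) by rewrite cx !inE.
case/imsetP => x' x'sx cx'; have /setD1P[x'x x's] := x'sx.
suff -> : A = [set x; x'] by rewrite cards2 eq_sym x'x.
apply/setP => z; rewrite !inE.
have [->|zx] /= := eqVneq z x; first by rewrite xs cx eqxx.
have [->|zx'] /= := eqVneq z x'.
  rewrite x's /=; apply/eqP; rewrite -cx; apply/setP => i.
  apply/imsetP/imsetP => -[w /setD1P[wx ws] ->].
    have [->|wx1] := eqVneq w x; first by exists x'.
    by exists w => //; apply/setD1P.
  have [->|wx1] := eqVneq w x'; first by exists x => //; rewrite !inE eq_sym x'x.
  by exists w => //; apply/setD1P.
apply/negP => /andP[zs /eqP cz].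
have czx : c z \in c @: (s :\ x) by apply: imset_f; rewrite !inE zx.
have : c z \in c @: (s :\ z) by rewrite cz -cx.
case/imsetP => w /setD1P[wz ws] cwz.
have [wx|wx] := eqVneq w x.
  by case/eqP: zx'; apply: cinj; rewrite ?inE ?zx ?x'x // cwz wx.
by case/eqP: wz; apply: cinj; rewrite ?inE ?zx ?wx.
Qed.

(** * Doors with an ordinary element and their two rooms *)

Section Door.
Variable t : {set X}.
Hypothesis dt : door t.

Let tI : #|t|.+1 = #|I|. Proof. by case/and3P: dt => /eqP. Qed.
Let domt : dominant t. Proof. by case/and3P: dt. Qed.
Let ct : c @: t = [set~ i0]. Proof. by case/and3P: dt => _ _ /eqP. Qed.

Let slack_door := [set e i | i in [set~ i0]].

Lemma door_slack : (forall x, x \in t -> exists k, x = e k) -> t = slack_door.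
Proof.
move=> H; apply/setP => x; apply/idP/imsetP.
  move=> xt; have [k xk] := H _ xt; exists k => //.
  by rewrite -ct -(colour_slack k) -xk imset_f.
move=> [k]; rewrite -ct => /imsetP[z zt ->] ->.
by have [l zl] := H _ zt; rewrite zl colour_slack -zl.
Qed.

Lemma door_ordinary : t != slack_door ->
  exists2 w, w \in t & forall k, w != e k.
Proof.
have [/exists_inP[w wt /forallP wN]|] := boolP [exists x in t, forall k, x != e k].
  by exists w.
rewrite negb_exists_in => /forall_inP H /eqP[]; apply: door_slack => x xt.
by have := H _ xt; rewrite negb_forall => /existsP[k /negPn/eqP]; exists k.
Qed.

Variable w : X.
Hypotheses (wt : w \in t) (wN : forall k, w != e k).

Let mn i := [arg min_(x < w in t) rk i x].
Let mn_t i : mn i \in t. Proof. by rewrite /mn; case: arg_minnP. Qed.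
Let mn_le i z : z \in t -> rk i (mn i) <= rk i z.
Proof. by rewrite /mn; case: arg_minnP => // x _; apply. Qed.

Let mnP i z : z \in t -> (forall x, x \in t -> rk i z <= rk i x) -> mn i = z.
Proof.
move=> zt zmin; apply: (@rk_inj i); apply/eqP.
by rewrite eqn_leq mn_le // zmin.
Qed.

(** These are the elements whose dominance over [t] can be witnessed by no index other than [j]. *)
Let above j := [pred y | [forall (i | i != j), rk i (mn i) < rk i y]].

Let aboveP j y :
  reflect (forall i, i != j -> rk i (mn i) < rk i y) (above j y).
Proof. exact: (iffP forall_inP). Qed.

(** The minima of [t] are at most the ordinary element [w], which [e j] exceeds in every order but
    [j]. This makes the maximum defining [top j] meaningful. *)
Let above_e j : above j (e j).
Proof.
apply/aboveP => i ij.
by apply: leq_ltn_trans (mn_le i wt) _; apply: rk_top; rewrite // eq_sym.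
Qed.

Let top j := [arg max_(y > e j | above j y) rk j y].

Let topP j : above j (top j) /\ forall y, above j y -> rk j y <= rk j (top j).
Proof. by rewrite /top; case: arg_maxnP; first exact: above_e. Qed.

Let above_below j y : above j y -> forall x, x \in t -> rk j y <= rk j x.
Proof.
move=> /aboveP yj; have /dominantP/(_ y)[i yi] := domt.
have [<-//|ij] := eqVneq i j.
by have := yi _ (mn_t i); rewrite leqNgt yj.
Qed.

(** For an element of [above j] the index [j] works, by maximality of [top j]. Any other element is
    at most the minimum of [t] in some order [i != j], and [top j] is above that minimum. *)
Let top_dominant j : dominant (top j |: t).
Proof.
have [tj tmax] := topP j; apply/dominantP => y.
have [yj|] := boolP (above j y).
  exists j => x; rewrite !inE => /predU1P[->|xt]; first exact: tmax.
  exact: above_below.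
rewrite negb_forall => /existsP[i]; rewrite negb_imply -leqNgt => /andP[ij yi].
exists i => x; rewrite !inE => /predU1P[->|xt].
  by apply: leq_trans yi _; apply: ltnW; move/aboveP: tj; apply.
exact: leq_trans yi (mn_le _ xt).
Qed.

Let mn_surj x : x \in t -> exists i, mn i = x.
Proof.
move=> xt; have /dominantP/(_ x)[i xi] := domt.
by exists i; apply: mnP.
Qed.

(** Dominance at [top j] can only use the index [j], since [mn i] is below [top j] in every other
    order [i]. Hence [x] attains the maximum. *)
Let above_dominant j x : dominant (x |: t) -> above j x -> x = top j.
Proof.
move=> /dominantP dx xj; have [tj tmax] := topP j.
have [i Hi] := dx (top j); have ij : i = j.
  apply/eqP; apply: contraTT isT => ij /=.
  have := Hi (mn i); rewrite !inE mn_t orbT => /(_ isT).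
  by rewrite leqNgt; move/aboveP: tj => ->.
apply: (@rk_inj j); apply/eqP; rewrite eqn_leq tmax //=.
by rewrite -{1 3}ij Hi // !inE eqxx.
Qed.

(** Minima map [I] onto [t], which has one element less, so exactly one pair [j], [k] of indices
    shares its minimum. The elements that complete [t] to a room are [top j] and [top k]. *)
Lemma card_rooms_regular_door :
  #|[set x | (x \notin t) && dominant (x |: t)]| = 2.
Proof.
have mn_onto : mn @: [set: I] = t.
  apply/setP => x; apply/imsetP/idP; first by case=> i _ ->; exact: mn_t.
  by move=> /mn_surj[i <-]; exists i.
have [j [k [jk mjk]]] : exists j k, j != k /\ mn j = mn k.
  have [/injectiveP/card_imset|] := boolP (injectiveb mn).
    move=> /(_ [set: I]); rewrite mn_onto cardsT -tI => /eqP.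
    by rewrite eqn_leq ltnn andbF.
  by move=> /injectivePn[j [k jk mjk]]; exists j, k.
have injC j' k' : j' != k' -> mn j' = mn k' -> {in [set~ j'] &, injective mn}.
  move=> jk' mjk'; apply/imset_injP.
  have -> : mn @: [set~ j'] = t.
    rewrite -mn_onto; apply/setP => x; apply/imsetP/imsetP.
      by case=> i _ ->; exists i.
    case=> i _ ->; have [->|ij] := eqVneq i j'.
      by exists k' => //; rewrite !inE eq_sym.
    by exists i => //; rewrite !inE.
  by rewrite cardsC1 -tI.
have injj := injC j k jk mjk.
have injk : {in [set~ k] &, injective mn} by apply: (injC k j) => //; rewrite eq_sym.
have topN l l' : l != l' -> mn l = mn l' -> top l \notin t.
  move=> ll' mll'; apply/negP => lt.
  have [/aboveP tl _] := topP l; have [i mi] := mn_surj lt.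
  have [il|il] := eqVneq i l; last by have := tl _ il; rewrite mi ltnn.
  have l'l : l' != l by rewrite eq_sym.
  by have := tl _ l'l; rewrite -mll' -mi il ltnn.
(* A common value would exceed the minimum of [t] in every order, against the dominance of [t]. *)
have top_neq : top j != top k.
  apply/eqP => jkE; have [/aboveP tj _] := topP j; have [/aboveP tk _] := topP k.
  have /dominantP/(_ (top j))[i /(_ _ (mn_t i))] := domt; rewrite leqNgt => /negP; apply.
  by have [->|ij] := eqVneq i j; [rewrite jkE tk|exact: tj].
suff -> : [set x | (x \notin t) && dominant (x |: t)] = [set top j; top k].
  by rewrite cards2 top_neq.
apply/setP => x; rewrite !inE; apply/idP/idP; last first.
  case/orP=> /eqP->; rewrite top_dominant andbT; first exact: (topN j k).
  by apply: (topN k j); rewrite // eq_sym.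
move=> /andP[xt dx].
have [xj|] := boolP (above j x); first by rewrite -(above_dominant dx xj) eqxx.
have [xk _|] := boolP (above k x).
  by rewrite -(above_dominant dx xk) eqxx orbT.
(* If [x] is below [mn i] in order [i != l], dominance at [mn i] needs another index with the same
   minimum, so [i] belongs to the colliding pair and equals [l']. An [x] in neither [above j] nor
   [above k] then lies below the shared minimum in both orders, and dominance fails there. *)
have bad l l' : l != l' -> {in [set~ l] &, injective mn} ->
    {in [set~ l'] &, injective mn} -> ~~ above l x -> rk l' x < rk l' (mn l').
  move=> ll' injl injl' /forallPn[i]; rewrite negb_imply -leqNgt => /andP[il xi].
  have /dominantP/(_ (mn i))[i' Hi'] := dx.
  have mi' : mn i' = mn i.
    by apply: mnP => [|z zt]; [exact: mn_t | apply: Hi'; rewrite !inE zt orbT].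
  have i'x : rk i' (mn i') <= rk i' x by rewrite mi' Hi' // !inE eqxx.
  have xiN : rk i x < rk i (mn i).
    rewrite ltn_neqAle xi andbT; apply/eqP => /rk_inj xE.
    by move: xt; rewrite xE mn_t.
  have ii' : i' != i.
    by apply/eqP => ii'; move: i'x; rewrite ii' leqNgt xiN.
  have [<-//|il'] := eqVneq i l'.
  have [i'l|i'l] := eqVneq i' l; last first.
    by move: ii'; rewrite (injl i' i) ?inE ?eqxx.
  by move: ii'; rewrite (injl' i' i) ?inE ?eqxx // i'l.
move=> xk xj; have kj : k != j by rewrite eq_sym.
have bk := bad _ _ jk injj injk xj; have bj := bad _ _ kj injk injj xk.
have /dominantP/(_ (mn j))[i Hi] := dx.
have mi : mn i = mn j.
  by apply: mnP => [|z zt]; [exact: mn_t | apply: Hi; rewrite !inE zt orbT].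
have ix : rk i (mn i) <= rk i x by rewrite mi Hi // !inE eqxx.
have [ij|ij] := eqVneq i j; first by move: ix; rewrite ij leqNgt bj.
have [ik|ik] := eqVneq i k; first by move: ix; rewrite ik leqNgt bk.
by move: ij; rewrite (injk i j) ?inE ?eqxx.
Qed.

End Door.

Let slack_door := [set e i | i in [set~ i0]].

Lemma slack_doorP : door slack_door.
Proof.
apply/and3P; split.
- by rewrite card_imset ?cardsC1 ?prednK //; [apply/card_gt0P; exists i0 | exact: slack_inj].
- apply/dominantP => y.
  have [/existsP[k /eqP->]|] := boolP [exists k, y == e k].
    by exists k => x _; exact: rk_bot.
  rewrite negb_exists => /forallP yN; exists i0 => x /imsetP[k].
  by rewrite !inE => ki0 ->; apply/ltnW/rk_top.
- rewrite -imset_comp; apply/eqP.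
  by rewrite (eq_imset (g := id)) ?imset_id // => i /=; rewrite colour_slack.
Qed.

(** An ordinary element can be dominated only through [i0], because every other order has its bottom
    [e i] in the door. The added element must therefore be the largest ordinary one in order
    [i0]. *)
Lemma card_rooms_slack_door :
  #|[set x | (x \notin slack_door) && dominant (x |: slack_door)]| = 1.
Proof.
pose P := [pred x | [forall k, x != e k]].
have Px0 : P x0 by apply/forallP.
pose xm := [arg max_(x > x0 | P x) rk i0 x].
have [/forallP xmN xmax] : P xm /\ forall y, P y -> rk i0 y <= rk i0 xm.
  by rewrite /xm; case: arg_maxnP.
suff -> : [set x | (x \notin slack_door) && dominant (x |: slack_door)] = [set xm].
  by rewrite cards1.
apply/setP => x; rewrite !inE; apply/idP/eqP => [/andP[xs dx]|->].
  have keyP y : P y -> rk i0 y <= rk i0 x.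
    move=> /forallP yN; have /dominantP/(_ y)[i Hi] := dx.
    have [ii|ii] := eqVneq i i0; first by rewrite -ii Hi // !inE eqxx.
    have := Hi (e i); rewrite !inE imset_f ?inE // orbT => /(_ isT) le.
    have /eqP/rk_inj yE : rk i y == rk i (e i) by rewrite eqn_leq le rk_bot.
    by move: (yN i); rewrite yE eqxx.
  apply: (@rk_inj i0); apply/eqP; rewrite eqn_leq keyP ?andbT; last exact/forallP.
  apply: xmax; apply/forallP => k; apply/eqP => xk.
  have [ki|ki] := eqVneq k i0; last first.
    by move: xs; rewrite xk imset_f ?inE.
  have := keyP _ Px0; rewrite xk ki => le.
  have /eqP/rk_inj yE : rk i0 x0 == rk i0 (e i0) by rewrite eqn_leq le rk_bot.
  by move: (x0N i0); rewrite yE eqxx.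
apply/andP; split.
  by apply/imsetP => -[k _ xk]; move: (xmN k); rewrite xk eqxx.
apply/dominantP => y.
have [/existsP[k /eqP->]|] := boolP [exists k, y == e k].
  by exists k => z _; exact: rk_bot.
rewrite negb_exists => yN; exists i0 => z; rewrite !inE => /predU1P[->|].
  exact: xmax.
by move=> /imsetP[k]; rewrite !inE => ki0 ->; apply/ltnW/rk_top => //; apply/forallP.
Qed.

(* Count modulo 2 the pairs of a door in a room: [slack_door] is in one room and
   any other door in two, while a room without all colours has an even number of
   doors. *)
Theorem scarf : exists s : {set X},
  [/\ #|s| = #|I|, c @: s = [set: I] & dominant s].
Proof.
have [/existsP[s /and3P[/eqP sI /eqP cs ds]]|] :=
    boolP [exists s : {set X}, [&& #|s| == #|I|, c @: s == [set: I] & dominant s]].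
  by exists s.
rewrite negb_exists => /forallP noRoom.
have sum_card (P Q : pred {set X}) : \sum_(s | P s) (Q s : nat) = #|[set s | P s && Q s]|.
  rewrite -sum1_card big_mkcond [RHS]big_mkcond; apply: eq_bigr => s _.
  by rewrite inE; case: (P s); case: (Q s).
have /(congr1 odd) : \sum_(t | door t) \sum_(s | room s) (t \subset s : nat)
    = \sum_(s | room s) \sum_(t | door t) (t \subset s : nat) by exact: exchange_big.
have -> : odd (\sum_(s | room s) \sum_(t | door t) (t \subset s : nat)) = false.
  apply/negbTE; elim/big_rec: _ => // s n /andP[/eqP sI ds] nE.
  rewrite oddD (negbTE nE) addbF sum_card.
  have csN : c @: s != [set: I].
    by have := noRoom s; rewrite sI eqxx ds andbT.
  suff -> : [set t | door t && (t \subset s)] =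
      [set t : {set X} | [&& #|t|.+1 == #|I|, c @: t == [set~ i0] & t \subset s]].
    rewrite (subsets_card1 (fun t => c @: t == [set~ i0]) sI).
    exact: even_doors_of_room.
  apply/setP => t; rewrite !inE /door.
  case ts : (t \subset s); last by rewrite !andbF.
  by rewrite (dominantS ts ds) !andbT.
have cardS t : door t -> \sum_(s | room s) (t \subset s : nat)
    = #|[set x | (x \notin t) && dominant (x |: t)]|.
  move=> /and3P[/eqP tI _ _]; rewrite sum_card -(supersets_card1 _ tI).
  by apply: eq_card => s; rewrite !inE /room andbA.
rewrite (bigD1 slack_door) /=; last exact: slack_doorP.
rewrite cardS; last exact: slack_doorP.
rewrite card_rooms_slack_door add1n /= => /negbFE.
suff -> : odd (\sum_(t | door t && (t != slack_door))
    \sum_(s | room s) (t \subset s : nat)) = false by [].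
apply/negbTE; elim/big_rec: _ => // t n /andP[dt tN] nE.
have [w wt wN] := door_ordinary dt tN.
by rewrite oddD (negbTE nE) addbF cardS // (card_rooms_regular_door dt wt wN).
Qed.
End Scarf.


(** The ordinary elements are the grid points of total weight [N], and [C] consists of the indices
    whose slack element is absent from the room. A slack in the room is the bottom of its own order,
    so dominance of a grid point is witnessed by an index in [C]. *)
Lemma scarf_grid (I : finType) (i0 : I) (N : nat) (c : {ffun I -> 'I_N.+1} -> I) :
  exists (C : {set I}) (x : I -> {ffun I -> 'I_N.+1}),
  [/\ exists i, i \in C,
      forall i, i \in C -> \sum_k x i k = N /\ c (x i) = i &
      forall y : {ffun I -> 'I_N.+1}, \sum_k y k = N ->
        exists2 i, i \in C & forall k, k \in C -> y i <= x k i].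
Proof.
pose G := {y : {ffun I -> 'I_N.+1} | \sum_k y k == N :> nat}.
pose X : finType := (G + I)%type.
pose big := (N.+1 * #|{: G}|).+1.
(* Grid points are compared by their coordinate [i], ties being broken by enumeration. The successor
   keeps them above the bottom slack, and [big] puts the other slacks above them all. *)
pose rk (i : I) (x : X) : nat := match x with
  | inl y => (sval y i * #|{: G}| + enum_rank y).+1
  | inr j => if j == i then 0 else big + enum_rank j end.
pose cX (x : X) : I := match x with inl y => c (sval y) | inr j => j end.
have rk_big i y : rk i (inl y) < big.
  rewrite /rk ltnS (leq_trans (n := (sval y i).+1 * #|{: G}|)) //.
    by rewrite mulSn addnC ltn_add2r.
  by rewrite leq_mul2r ltn_ord orbT.
have y0P : \sum_k [ffun k => if k == i0 then ord_max else ord0 : 'I_N.+1] k == N :> nat.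
  rewrite (bigD1 i0) //= ffunE eqxx big1 ?addn0 // => k /negbTE ki.
  by rewrite ffunE ki.
pose inG (y : {ffun I -> 'I_N.+1}) (h : \sum_k y k == N :> nat) : G :=
  exist (fun y : {ffun I -> 'I_N.+1} => \sum_k y k == N :> nat) y h.
pose y0 : G := inG _ y0P.
have rk_inj i : injective (rk i).
  move=> [y|j] [z|k].
  - move=> /= [] /(congr1 (modn ^~ #|{: G}|)) /=; rewrite !modnMDl !modn_small //.
    by move=> /val_inj/enum_rank_inj ->.
  - move=> E; have := rk_big i y; rewrite E /=; case: ifP => [ki|ki].
      by move: E; rewrite /= ki.
    by rewrite ltnNge leq_addr.
  - move=> E; have := rk_big i z; rewrite -E /=; case: ifP => [ki|ki].
      by move: E; rewrite /= ki.
    by rewrite ltnNge leq_addr.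
  - rewrite /=; case: eqP => [->|_]; case: eqP => [->|_] // /addnI.
    by move=> /val_inj/enum_rank_inj ->.
have rk_bot i x : rk i (inr i) <= rk i x by rewrite /= eqxx.
have rk_top i j x : j != i -> (forall k, x != inr k :> X) -> rk i x < rk i (inr j).
  move=> ji; case: x => [y _|k /(_ k)]; last by rewrite eqxx.
  by apply: leq_trans (rk_big i y) _; rewrite /= (negbTE ji) leq_addr.
have [s [sI cs ds]] := @scarf X I rk inr cX rk_inj rk_bot rk_top
  (fun=> erefl) (inl y0) (fun=> isT) i0.
have cinj : {in s &, injective cX} by apply/imset_injP; rewrite cs cardsT sI.
pose C := [set i | inr i \notin s].
(* For [i] in [C] the element of colour [i] in the room is a grid point, so the default [y0] is
   never taken there. *)
pose x (i : I) : {ffun I -> 'I_N.+1} :=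
  odflt (sval y0) (omap sval [pick y : G | (inl y \in s) && (cX (inl y) == i)]).
have xP i : i \in C -> exists2 y : G, inl y \in s & x i = sval y /\ c (x i) = i.
  rewrite inE => iC; rewrite /x; case: pickP => [y /andP[ys /eqP cy]|no].
    by exists y.
  have : i \in cX @: s by rewrite cs inE.
  case/imsetP => -[y|j] ys E; first by have := no y; rewrite ys E eqxx.
  by move: iC; rewrite E ys.
exists C, x; split.
- have /dominantP/(_ (inl y0))[i Hi] := ds; exists i; rewrite inE.
  by apply/negP => /Hi; rewrite /= eqxx.
- by move=> i /xP[y _ [xE cx]]; rewrite cx xE; split => //; apply/eqP/(svalP y).
move=> y /eqP yN; have /dominantP/(_ (inl (inG y yN)))[i Hi] := ds.
exists i; first by rewrite inE; apply/negP => /Hi; rewrite /= eqxx.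
move=> k /xP[z zs [-> _]]; have := Hi _ zs; rewrite /= ltnS.
apply: contraTT; rewrite -!ltnNge => zy.
apply: (@leq_trans ((sval z i).+1 * #|{: G}|)).
  by rewrite mulSn addnC ltn_add2r.
by rewrite (leq_trans _ (leq_addr _ _)) // leq_mul2r zy orbT.
Qed.

(** Let [m i] be the least [i]-th coordinate over the room. Some grid point would exceed all [m i]
    with [i] in [C] if [N] were at least the sum of the [(m i).+1]. So the [m i] sum to more than
    [N - #|C|], which leaves each point less than [#|C|] to distribute above them or outside [C]. *)
Lemma scarf_grid_close (I : finType) (i0 : I) (N : nat)
    (c : {ffun I -> 'I_N.+1} -> I) :
  exists (C : {set I}) (x : I -> {ffun I -> 'I_N.+1}),
  [/\ exists i, i \in C,
      forall i, i \in C -> \sum_k x i k = N /\ c (x i) = i,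
      forall i k, k \in C -> i \notin C -> x k i <= #|I| &
      forall i k l, k \in C -> l \in C -> x k i <= x l i + #|I|].
Proof.
have [C [x [[i1 i1C] xP xmax]]] := scarf_grid i0 c.
pose m i : nat := x [arg min_(k < i1 in C) x k i] i.
have m_le i k : k \in C -> m i <= x k i.
  by rewrite /m; case: arg_minnP => // l lC; apply.
have m_ex i : exists2 k, k \in C & m i = x k i.
  by rewrite /m; case: arg_minnP => // l lC _; exists l.
have sumC k : k \in C -> \sum_(i in C) m i <= \sum_(i in C) x k i.
  by move=> kC; apply: leq_sum => i _; exact: m_le.
have key : N < \sum_(i in C) m i + #|C|.
  rewrite ltnNge; apply/negP => le.
  have leC : \sum_(i in C) (m i).+1 <= N.
    by rewrite (eq_bigr (fun i => m i + 1)) ?big_split /= ?sum1_card // => i _; rewrite addn1.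
  pose r := \sum_(i in C | i != i1) (m i).+1.
  have leC1 : (m i1).+1 + r <= N by rewrite -(bigD1 i1) in leC *.
  (* The forbidden grid point: one more than the minimum at each index of [C], with all remaining
     weight put on [i1]. *)
  pose f i : nat := if i == i1 then N - r else if i \in C then (m i).+1 else 0.
  have fN i : f i <= N.
    rewrite /f; case: ifP => _; first exact: leq_subr.
    case: ifP => // iC; apply: leq_trans leC.
    by rewrite (bigD1 i iC) /= leq_addr.
  have fE i : [ffun i => inord (f i) : 'I_N.+1] i = f i :> nat.
    by rewrite ffunE inordK // ltnS.
  have [|i iC] := xmax [ffun i => inord (f i)].
    rewrite (eq_bigr _ (fun i _ => fE i)) (bigD1 i1) //= /f eqxx.
    suff -> : \sum_(i | i != i1) f i = r.
      by rewrite subnK // (leq_trans _ leC1) // leq_addl.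
    rewrite /r big_mkcondl; apply: eq_bigr => i /negbTE ii1.
    by rewrite /f ii1.
  have [k kC mk] := m_ex i; move=> /(_ k kC); rewrite fE -mk /f iC.
  case: ifP => [/eqP->|_]; last by rewrite ltnn.
  by rewrite leqNgt ltn_subRL addnC leC1.
have small i k : k \in C -> i \notin C -> x k i <= #|C|.
  move=> kC iC; have [xkN _] := xP k kC.
  have := leq_trans key (leq_add (sumC k kC) (leqnn _)).
  rewrite -[X in X < _]xkN (bigID (mem C)) /= ltn_add2l => /ltnW; apply: leq_trans.
  by rewrite (bigD1 i iC) /= leq_addr.
have CI : #|C| <= #|I| by rewrite -cardsT subset_leq_card // subsetT.
exists C, x; split=> //; first by exists i1.
  by move=> i k kC iC; apply: leq_trans CI; exact: small.
move=> i k l kC lC; have [iC|iC] := boolP (i \in C); last first.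
  by apply: leq_trans (small _ _ kC iC) _; rewrite (leq_trans CI) // leq_addl.
apply: leq_trans (leq_add (m_le i l lC) CI).
have [xkN _] := xP k kC; apply: ltnW.
rewrite -(ltn_add2r (\sum_(j in C | j != i) m j)) addnAC -(bigD1 i iC) /=.
apply: leq_trans key; rewrite ltnS -[X in _ <= X]xkN [X in _ <= X](bigID (mem C)) /=.
rewrite [X in _ <= X + _](bigD1 i) //= -addnA.
rewrite leq_add2l (leq_trans _ (leq_addr _ _)) //.
by apply: leq_sum => j _; exact: m_le.
Qed.

End Combinatorics.

Local Open Scope classical_set_scope.
Local Open Scope ring_scope.

(** * A dual KKM lemma *)

Lemma compact_seq_cluster (R : realType) (V : normedModType R) (A : set V)
    (u : nat -> V) : compact A -> (forall k, A (u k)) ->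
  exists2 p, A p & forall e : R, 0 < e -> forall k0, exists2 k, (k0 <= k)%N & `|p - u k| < e.
Proof.
move=> Ac Au; have [|p [Ap clp]] := Ac (u @ \oo) _.
  by exists 0%N => // k _; exact: Au.
exists p => // e e0 k0.
have [] := clp [set u k | k in [set k | (k0 <= k)%N]] (ball p e).
- by exists k0 => // k /= kk; exists k.
- exact: nbhsx_ballx.
by move=> _ [[k /= kk <-]]; rewrite -ball_normE /=; exists k.
Qed.

Lemma closed_approx (R : realType) (V : normedModType R) (F : set V) (p : V) :
  closed F -> (forall e : R, 0 < e -> exists2 z, F z & `|p - z| < e) -> F p.
Proof.
move=> Fc H; apply: Fc => B /nbhs_ballP[e /= e0 eB].
have [z Fz pz] := H _ e0; exists z; split => //; apply: eB.
by rewrite -ball_normE.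
Qed.

Lemma continuous_sum (R : realType) (T : topologicalType) (V : normedModType R)
    (I : Type) (s : seq I) (P : pred I) (f : I -> T -> V) :
  (forall i, continuous (f i)) -> continuous (fun x => \sum_(i <- s | P i) f i x).
Proof.
by move=> fc; apply: continuous_big => // x; exact: add_continuous.
Qed.

Definition simplex (R : realType) n : set 'rV[R]_n.+1 :=
  [set r | (forall i, 0 <= r ord0 i) /\ \sum_i r ord0 i = 1].

Lemma rV_coord_le (R : realType) n (r : 'rV[R]_n.+1) i : `|r ord0 i| <= `|r|.
Proof.
rewrite [leRHS]/Num.norm /= mx_normrE.
exact: (le_bigmax _ (fun ij => `|r ij.1 ij.2|) (ord0, i)).
Qed.

Lemma rV_norm_le (R : realType) n (r : 'rV[R]_n.+1) (e : R) :
  0 <= e -> (forall i, `|r ord0 i| <= e) -> `|r| <= e.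
Proof.
move=> e0 H; rewrite /Num.norm /= mx_normrE; apply: bigmax_le => // -[i j] _ /=.
by rewrite (ord1 i).
Qed.

Lemma simplex_le1 (R : realType) n (r : 'rV[R]_n.+1) i : simplex r -> r ord0 i <= 1.
Proof.
by move=> [r0 <-]; rewrite (bigD1 i) //= lerDl sumr_ge0.
Qed.

Lemma simplex_compact (R : realType) n : compact (@simplex R n).
Proof.
apply: bounded_closed_compact.
  exists 1; split => // x x1 r sr; apply: le_trans (ltW x1).
  apply: rV_norm_le => // i; rewrite ger0_norm; last by case: sr.
  exact: simplex_le1.
have -> : @simplex R n = \bigcap_i [set r | 0 <= r ord0 i] `&` [set r | \sum_i r ord0 i = 1].
  apply/seteqP; split => r [r0 r1]; split => // i; first by move=> _; exact: r0.
  exact: r0.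
apply: closedI.
  apply: closed_bigI => i _.
  apply: (@preimage_closed _ _ (fun r : 'rV[R]_n.+1 => r ord0 i) [set x | 0 <= x]).
    by move=> r _; exact: coord_continuous.
  exact: closed_ge.
apply: (@preimage_closed _ _ (fun r : 'rV[R]_n.+1 => \sum_i r ord0 i) [set x | x = 1]).
  by move=> r _; apply: continuous_sum => i; exact: coord_continuous.
exact: closed_eq.
Qed.

(** The conclusion of [dual_kkm] up to an error [e], with one point [x i] for each [i] in [C] in
    place of a common point. *)
Definition approx_face (R : realType) n (F : 'I_n.+1 -> set 'rV[R]_n.+1)
    (C : {set 'I_n.+1}) (e : R) : Prop :=
  (exists i, i \in C) /\ exists x : 'I_n.+1 -> 'rV[R]_n.+1,
  [/\ forall i, i \in C -> simplex (x i) /\ F i (x i),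
      forall i k, k \in C -> i \notin C -> x k ord0 i <= e &
      forall k l, k \in C -> l \in C -> `|x k - x l| <= e].

(** Colour each grid point of mesh [1 / N.+1] by a set [F i] containing it; the discrepancy [n.+1]
    of [scarf_grid_close] shrinks to [n.+1 / N.+1]. *)
Lemma approx_face_ex (R : realType) n (F : 'I_n.+1 -> set 'rV[R]_n.+1) (e : R) :
  (forall r, simplex r -> exists i, F i r) -> 0 < e ->
  exists C, approx_face F C e.
Proof.
move=> Fcov e0.
have [N Ne] : exists N : nat, n.+1%:R / N.+1%:R <= e.
  pose N := Num.truncn (n.+1%:R / e); exists N.
  rewrite ler_pdivrMr ?ltr0n // -ler_pdivrMl // mulrC.
  exact: ltW (truncnS_gt _).
pose pt (y : {ffun 'I_n.+1 -> 'I_N.+2}) : 'rV[R]_n.+1 := \row_i ((y i)%:R / N.+1%:R).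
have ptS (y : {ffun 'I_n.+1 -> 'I_N.+2}) : (\sum_k y k = N.+1)%N -> simplex (pt y).
  move=> yN; split=> [i|]; first by rewrite mxE divr_ge0.
  under eq_bigr do rewrite mxE.
  by rewrite -mulr_suml -natr_sum yN divff // pnatr_eq0.
have /choice[c cP] : forall y : {ffun 'I_n.+1 -> 'I_N.+2}, exists i,
    (\sum_k y k = N.+1)%N -> F i (pt y).
  move=> y.
  have [/ptS/Fcov[i Fi]|ne] := pselect (\sum_k y k = N.+1)%N; first by exists i.
  by exists ord0.
have [C [x [C0 xC xsmall xclose]]] := scarf_grid_close ord0 c.
exists C; split=> //; exists (pt \o x); split.
- move=> i iC; have [xN ci] := xC i iC; split; first exact: ptS.
  by rewrite -{1}ci; exact: cP.
- move=> i k kC iC; rewrite mxE; apply: le_trans Ne.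
  by rewrite ler_pM2r ?invr_gt0 ?ltr0n // ler_nat -[X in (_ <= X)%N](card_ord n.+1) xsmall.
move=> k l kC lC; apply: le_trans Ne; apply: rV_norm_le => [|i].
  by rewrite divr_ge0.
rewrite !mxE -mulrBl normrM [X in _ * X]ger0_norm ?invr_ge0 //.
rewrite ler_pM2r ?invr_gt0 ?ltr0n // ler_distl.
have := xclose i k l kC lC; have := xclose i l k lC kC.
rewrite card_ord -!(ler_nat R) !natrD => h1 h2.
by rewrite lerBlDr h1 h2.
Qed.

Lemma approx_face_le (R : realType) n (F : 'I_n.+1 -> set 'rV[R]_n.+1) C (d e : R) :
  d <= e -> approx_face F C d -> approx_face F C e.
Proof.
move=> de [C0 [x [xC xs xc]]]; split => //; exists x; split => // [i k kC iC|k l kC lC].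
  exact: le_trans (xs _ _ kC iC) de.
exact: le_trans (xc _ _ kC lC) de.
Qed.

(** There are finitely many [C], so one of them serves every tolerance: otherwise the least failing
    tolerance contradicts [approx_face_ex]. For this [C] the points cluster at a common [r] as the
    tolerance tends to [0]. *)
Lemma dual_kkm (R : realType) n (F : 'I_n.+1 -> set 'rV[R]_n.+1) :
  (forall i, closed (F i)) -> (forall r, simplex r -> exists i, F i r) ->
  exists (C : {set 'I_n.+1}) (r : 'rV[R]_n.+1),
  [/\ simplex r, exists i, i \in C, forall i, i \in C -> F i r &
      forall i, i \notin C -> r ord0 i = 0].
Proof.
move=> Fcl Fcov.
have [C HC] : exists C, forall e : R, 0 < e -> approx_face F C e.
  apply: contrapT => /forallNP H.
  have /choice[d dP] : forall C : {set 'I_n.+1}, exists d : R,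
      0 < d /\ ~ approx_face F C d.
    move=> C.
    by have /existsNP[e /not_implyP] := H C; exists e.
  have [|C] := @approx_face_ex _ _ F (\big[Num.min/1]_C d C) Fcov.
    by apply: lt_bigmin => // C _; case: (dP C).
  have [_ dC] := dP C; move=> h; apply: dC; apply: approx_face_le h.
  exact: bigmin_le_cond.
have [[i1 i1C] _] := HC 1 ltr01.
have inv_gt0 k : 0 < k.+1%:R^-1 :> R by rewrite invr_gt0 ltr0n.
have [x xP] := choice (fun k : nat => (HC _ (inv_gt0 k)).2).
have [|p sp clp] := compact_seq_cluster (u := fun k => x k i1) (@simplex_compact R n).
  by move=> k; have [/(_ i1 i1C)[]] := xP k.
have near (e : R) : 0 < e -> exists k, [/\ k.+1%:R^-1 < e & `|p - x k i1| < e].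
  move=> e0; have [k kk pk] := clp e e0 (Num.truncn e^-1).
  exists k; split=> //; rewrite invf_plt ?posrE ?ltr0n //.
  apply: lt_le_trans (truncnS_gt _) _; by rewrite ler_nat ltnS.
exists C, p; split => //; first by exists i1.
  move=> i iC; apply: closed_approx => // e e0.
  have [k [ke pk]] := near (e / 2) (divr_gt0 e0 (ltr0Sn R 1)).
  have [xC _ xc] := xP k; exists (x k i); first by case: (xC i iC).
  rewrite (splitr e); apply: le_lt_trans (ler_distD (x k i1) _ _) _.
  by rewrite ltrD // (le_lt_trans (xc _ _ i1C iC)).
move=> i iC; apply/eqP; rewrite eq_le (proj1 sp i) andbT.
apply/ler_addgt0Pr => e e0; rewrite add0r.
have [k [ke pk]] := near (e / 2) (divr_gt0 e0 (ltr0Sn R 1)).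
have [_ xs _] := xP k.
rewrite -[p ord0 i](subrK (x k i1 ord0 i)) (splitr e) lerD //.
  apply: le_trans (ler_norm _) _; apply: le_trans (ltW pk).
  by have := rV_coord_le (p - x k i1) i; rewrite !mxE.
by apply: le_trans (xs _ _ i1C iC) (ltW ke).
Qed.

Lemma compact_net (R : realType) (V : normedModType R) (A : set V) (e : R) :
  compact A -> 0 < e -> exists N (q : 'I_N -> V),
  (forall k, A (q k)) /\ forall a, A a -> exists k, `|a - q k| < e.
Proof.
rewrite compact_cover => Ac e0.
have [|a Aa|D' D'A D'cov] := Ac V A (fun q => ball q e).
- by move=> q _; exact: ball_open.
- by exists a => //; exact: ballxx.
pose s := in_tuple (enum_fset D').
exists _, (tnth s); split=> [k|a /D'cov[q /= qD']].
  by apply/set_mem/D'A; rewrite -[_ \in D']/(_ \in enum_fset D') mem_tnth.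
rewrite -ball_normE /= distrC => aq.
have /tnthP[k kq] : q \in s by exact: qD'.
by exists k; rewrite -kq.
Qed.

(* For a continuous map [phi] into the face opposite to [ord0], apply [dual_kkm]
   to [F ord0 := Q] and [F j := P `&` [r | r_j <= (1 - r_0) phi_j r]]; here
   [phi] is the average of [g] against the tent functions of a finite net. *)
Lemma simplex_eigenvector (R : realType) n (P Q : set 'rV[R]_n.+2)
    (g : 'rV[R]_n.+2 -> 'I_n.+1) (eta : R) :
  closed P -> closed Q -> (forall r, simplex r -> P r \/ Q r) ->
  (forall r, simplex r -> r ord0 ord0 = 0 -> ~ P r) ->
  (forall r, simplex r -> r ord0 ord0 = 1 -> ~ Q r) -> 0 < eta ->
  exists (r : 'rV[R]_n.+2) N (w : 'I_N -> R) (q : 'I_N -> 'rV[R]_n.+2),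
  [/\ [/\ simplex r, P r & Q r], forall k, 0 <= w k, \sum_k w k = 1,
      forall k, 0 < w k -> `|r - q k| < eta &
      forall j, r ord0 (lift ord0 j) =
        (1 - r ord0 ord0) * \sum_(k | g (q k) == j) w k].
Proof.
move=> Pcl Qcl PQ P0 Q1 eta0.
have [N [q [_ qnet]]] := compact_net (@simplex_compact R n.+1) eta0.
(* Twice the positive part of [eta - |r - q k|]; dividing by [S] gives a partition of unity. *)
pose phi k (r : 'rV[R]_n.+2) : R := (eta - `|r - q k|) + `|eta - `|r - q k| |.
pose Phi (j : 'I_n.+1) r := \sum_(k | g (q k) == j) phi k r.
pose S r := \sum_k phi k r.
have phi_ge0 k r : 0 <= phi k r by rewrite /phi -lerBlDr sub0r lerNnormlW.
have phi_gt0 k r : (0 < phi k r) = (`|r - q k| < eta).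
  rewrite /phi; case: (ltP (`|r - q k|) eta) => h.
    by rewrite ltr_wpDr // subr_gt0.
  by rewrite ler0_norm ?subr_le0 // addrN ltxx.
have Phi_ge0 j r : 0 <= Phi j r by apply: sumr_ge0.
have sumPhi r : \sum_j Phi j r = S r.
  by rewrite /S (partition_big (g \o q) predT) //=; apply: eq_bigr => j _; apply: eq_bigl => k.
have S_gt0 r : simplex r -> 0 < S r.
  move=> /qnet[k rk]; rewrite /S (bigD1 k) //= ltr_wpDr ?sumr_ge0 //.
  by rewrite phi_gt0.
have sum1 (r : 'rV[R]_n.+2) : simplex r -> \sum_j r ord0 (lift ord0 j) = 1 - r ord0 ord0.
  by move=> [_ <-]; rewrite [in RHS]big_ord_recl addrAC subrr add0r.
have phi_cont k : continuous (phi k).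
  move=> r.
  have uc : eta - `|r - q k| @[r --> r] --> eta - `|r - q k|.
    exact: (cvgB (cvg_cst eta) (cvg_norm (cvgB cvg_id (cvg_cst (q k))))).
  exact: (cvgD uc (cvg_norm uc)).
pose E (j : 'I_n.+1) := [set r : 'rV[R]_n.+2 |
  r ord0 (lift ord0 j) * S r <= (1 - r ord0 ord0) * Phi j r].
have E_closed j : closed (E j).
  have -> : E j = (fun r : 'rV[R]_n.+2 =>
      (1 - r ord0 ord0) * Phi j r - r ord0 (lift ord0 j) * S r)
      @^-1` [set x | 0 <= x].
    by apply/seteqP; split => r /=; rewrite subr_ge0.
  apply: preimage_closed; last exact: closed_ge.
  move=> r _; have cc i : (x : 'rV[R]_n.+2) ord0 i @[x --> r] --> r ord0 i.
    exact: coord_continuous.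
  have Sc : S x @[x --> r] --> S r by exact: continuous_sum.
  have Phic : Phi j x @[x --> r] --> Phi j r by exact: continuous_sum.
  by have cv := cvgB (cvgM (cvgB (cvg_cst (1 : R)) (cc ord0)) Phic)
    (cvgM (cc (lift ord0 j)) Sc); exact: cv.
pose F i := if unlift ord0 i is Some j then P `&` E j else Q.
have [| |C [r [sr [i1 i1C] FC NC]]] := @dual_kkm R _ F.
- move=> i; rewrite /F; case: unlift => [j|] //.
  by apply: closedI.
- move=> r sr; have [Pr|Qr] := PQ r sr; last by exists ord0; rewrite /F unlift_none.
  suff [j Ej] : exists j, E j r by exists (lift ord0 j); rewrite /F liftK.
  apply: contrapT => /forallNP nE.
  (* Both sums equal [(1 - r_0) * S r], so the inequalities defining the [E j] cannot all fail. *)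
  suff : \sum_j r ord0 (lift ord0 j) * S r > \sum_j (1 - r ord0 ord0) * Phi j r.
    by rewrite -mulr_suml -mulr_sumr sumPhi sum1 // ltxx.
  apply: ltr_sum => [|j _]; first by apply/hasP; exists ord0; rewrite ?mem_index_enum.
  by rewrite ltNge; apply/negP; exact: nE.
(* The face [C] contains the slack index, as otherwise [r_0 = 0] and [P r]; it contains another
   index, as otherwise [r_0 = 1] and [Q r]. *)
have r0 : ord0 \in C.
  apply: contrapT => /negP nC; apply: (P0 r sr (NC _ nC)).
  have := FC _ i1C; rewrite /F; case: unliftP => [j _ []//|i10].
  by move: nC; rewrite -i10 i1C.
have Qr : Q r by have := FC _ r0; rewrite /F unlift_none.
have [j1 j1C] : exists j, lift ord0 j \in C.
  apply: contrapT => /forallNP nC; apply: (Q1 r sr _ Qr).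
  apply/eqP; rewrite eq_sym -subr_eq0 -sum1 // big1 // => j _.
  by apply: NC; apply/negP; exact: nC.
have Pr : P r by have := FC _ j1C; rewrite /F liftK => -[].
have t_ge0 : 0 <= 1 - r ord0 ord0 by rewrite subr_ge0 simplex_le1.
have Er j : E j r.
  have [jC|jC] := boolP (lift ord0 j \in C).
    by have := FC _ jC; rewrite /F liftK => -[].
  by rewrite /E /= NC // mul0r mulr_ge0.
(* Inequalities between families with equal sums are equalities. *)
have Eeq j : r ord0 (lift ord0 j) * S r = (1 - r ord0 ord0) * Phi j r.
  apply/esym/eqP; rewrite -subr_eq0; apply/eqP.
  apply: (@psumr_eq0P _ _ predT (fun j => (1 - r ord0 ord0) * Phi j r
            - r ord0 (lift ord0 j) * S r)) => // [i _|].
    by rewrite subr_ge0; exact: Er.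
  by rewrite sumrB -mulr_suml -mulr_sumr sumPhi sum1 // subrr.
have Sr := S_gt0 r sr; have Sr0 : S r != 0 by rewrite gt_eqF.
exists r, N, (fun k => phi k r / S r), q; split => //.
- by move=> k; rewrite divr_ge0 // ltW.
- by rewrite -mulr_suml divff.
- by move=> k; rewrite pmulr_lgt0 ?invr_gt0 // phi_gt0.
by move=> j; rewrite -mulr_suml mulrA -Eeq mulfK.
Qed.

(** * Normal cones and convex hulls *)

Lemma cone_sum (R : realType) (X : normedModType R) (K : set X) (I : finType)
    (P : pred I) (f : I -> X) :
  is_cone K -> K 0 -> (forall i, P i -> K (f i)) -> K (\sum_(i | P i) f i).
Proof.
move=> [_ Kconv Kscale _] K0 Kf; elim/big_ind: _ => // a b Ka Kb.
have half_ge0 : 0 <= 2^-1 :> R by rewrite invr_ge0.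
have half_le1 : 2^-1 <= 1 :> R by lra.
have := Kscale _ 2 (Kconv a b 2^-1 half_ge0 half_le1 Ka Kb) (ler0n _ _).
have -> : 1 - 2^-1 = 2^-1 :> R by lra.
by rewrite -scalerDr scalerA divff ?scale1r // pnatr_eq0.
Qed.

(** Group the terms by a point of an [m / 2]-net of [V] close to [v i]. A group of weight [SJ] stays
    within [SJ * (m / 2)] of a vector of norm at least [SJ * m], and normality bounds its norm by
    [c] times that of the whole sum. *)
Lemma cone_hull_norm_ge (R : realType) (X : normedModType R) (K : set X)
    (c m : R) (V : set X) :
  is_cone K -> normal_cone K c -> compact V -> V `<=` K -> 0 < m ->
  (forall v, V v -> m <= `|v|) ->
  exists2 delta : R, 0 < delta & forall n (s : 'I_n -> R) (v : 'I_n -> X),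
    (forall i, 0 <= s i) -> (forall i, V (v i)) ->
    delta * \sum_i s i <= `|\sum_i s i *: v i|.
Proof.
move=> Kcone [c0 Knorm] Vc VK m0 Vm; have m20 : 0 < m / 2 by rewrite divr_gt0.
have [N [q [qV qnet]]] := compact_net Vc m20.
(* There are only [N] groups; [N.+1] keeps the constant positive when the net is empty. *)
have D0 : 0 < m / 2 / c / N.+1%:R by rewrite !divr_gt0 // ltr0n.
exists (m / 2 / c / N.+1%:R) => // n s v s0 vV.
have [f fP] := choice (fun i => qnet _ (vV i)).
set tot := \sum_i s i *: v i.
have Sle J : m / 2 * \sum_(i | f i == J) s i <= c * `|tot|.
  pose u := \sum_(i | f i == J) s i *: v i; pose SJ := \sum_(i | f i == J) s i.
  have SJ0 : 0 <= SJ by apply: sumr_ge0.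
  have Ksv i : K (s i *: v i) by case: Kcone => _ _ Ks _; apply: Ks => //; exact: VK.
  have K0 : K 0.
    by case: Kcone => _ _ Ks _; rewrite -(scale0r (q J)); apply: Ks => //; exact: VK.
  apply: (@le_trans _ _ `|u|); last first.
    apply: Knorm; rewrite /cone_le ?subr0; first exact: cone_sum.
    rewrite /tot (bigID (fun i => f i == J)) /= addrAC subrr add0r.
    exact: cone_sum.
  have dist : `|SJ *: q J - u| <= SJ * (m / 2).
    rewrite scaler_suml -sumrB mulr_suml; apply: le_trans (ler_norm_sum _ _ _) _.
    apply: ler_sum => i /eqP <-; rewrite -scalerBr normrZ ger0_norm //.
    by rewrite ler_wpM2l // distrC ltW.
  have : SJ * m <= `|SJ *: q J| by rewrite normrZ ger0_norm // ler_wpM2l // Vm.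
  have := lerB_dist (SJ *: q J) u; rewrite -/SJ; lra.
have Sle' J : \sum_(i | f i == J) s i <= c * `|tot| / (m / 2).
  by rewrite ler_pdivlMr // mulrC.
have -> : \sum_i s i = \sum_J \sum_(i | f i == J) s i.
  by rewrite (partition_big f predT).
have h : \sum_J \sum_(i | f i == J) s i <= N.+1%:R * (c * `|tot| / (m / 2)).
  apply: le_trans (ler_sum _ (fun J _ => Sle' J)) _.
  rewrite sumr_const card_ord -[leLHS]mulr_natl ler_wpM2r ?ler_nat //.
  by rewrite divr_ge0 ?mulr_ge0 // ltW.
apply: le_trans (ler_wpM2l (ltW D0) h) _.
rewrite le_eqVlt; apply/orP; left; apply/eqP; field.
by rewrite ?gt_eqF // pnatr_eq0.
Qed.

(** * Convex hulls of compact sets *)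

Definition hull (R : realType) (X : normedModType R) (V : set X) : set X :=
  [set a | exists n (s : 'I_n -> R) (v : 'I_n -> X),
    [/\ forall i, 0 <= s i, \sum_i s i = 1, forall i, V (v i) &
        a = \sum_i s i *: v i]].

Lemma lincomb_dist (R : realType) (X : normedModType R) n (r r' : 'rV[R]_n.+1)
    (b : 'I_n.+1 -> X) :
  `|\sum_j r ord0 j *: b j - \sum_j r' ord0 j *: b j| <=
  `|r - r'| * \sum_j `|b j|.
Proof.
rewrite -sumrB mulr_sumr; apply: le_trans (ler_norm_sum _ _ _) _.
apply: ler_sum => j _; rewrite -scalerBl normrZ ler_wpM2r //.
by have := rV_coord_le (r - r') j; rewrite !mxE.
Qed.

(** Round the vectors to a net of [V], then the collected weights to a net of the simplex; each
    rounding costs at most [e / 2]. *)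
Lemma hull_net (R : realType) (X : normedModType R) (V : set X) (e : R) :
  compact V -> 0 < e -> exists N (p : 'I_N -> X),
  forall a, hull V a -> exists k, `|a - p k| < e.
Proof.
move=> Vc e0; have e20 : 0 < e / 2 by rewrite divr_gt0.
have [[|N] [q [qV qnet]]] := compact_net Vc e20.
  exists 0%N, (fun=> 0) => a [[|n] [s [v [_ s1 vV _]]]].
    by move/eqP: s1; rewrite big_ord0 eq_sym oner_eq0.
  by have [[]] := qnet _ (vV ord0).
pose B := \sum_j `|q j|; have B0 : 0 <= B by apply: sumr_ge0.
have eta0 : 0 < e / 2 / (B + 1) by rewrite divr_gt0 // ltr_wpDl.
have [L [t [_ tnet]]] := compact_net (@simplex_compact R N) eta0.
exists L, (fun l => \sum_j t l ord0 j *: q j) => a [n [s [v [s0 s1 vV ->]]]].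
have [f fP] := choice (fun i => qnet _ (vV i)).
pose r : 'rV[R]_N.+1 := \row_j \sum_(i | f i == j) s i.
have sr : simplex r.
  split=> [j|]; first by rewrite mxE sumr_ge0.
  by under eq_bigr do rewrite mxE; rewrite -s1 [RHS](partition_big f predT).
have [l rl] := tnet _ sr; exists l.
apply: le_lt_trans (ler_distD (\sum_j r ord0 j *: q j) _ _) _.
rewrite (splitr e) ltr_leD //; last first.
  apply: le_trans (lincomb_dist _ _ _) _; rewrite -/B.
  apply: (@le_trans _ _ (e / 2 / (B + 1) * B)); first by rewrite ler_wpM2r // ltW.
  by rewrite mulrAC ler_pdivrMr ?ltr_wpDl // ler_wpM2l ?lerDl ?ltW.
have -> : \sum_j r ord0 j *: q j = \sum_i s i *: q (f i).
  rewrite [RHS](partition_big f predT) //=; apply: eq_bigr => j _.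
  by rewrite mxE scaler_suml; apply: eq_bigr => i /eqP ->.
rewrite -sumrB; apply: le_lt_trans (ler_norm_sum _ _ _) _.
have <- : \sum_i s i * (e / 2) = e / 2 by rewrite -mulr_suml s1 mul1r.
under eq_bigr do rewrite -scalerBr normrZ (ger0_norm (s0 _)).
(* One positive weight makes the bound on the whole sum strict. *)
have [i si] : exists i, 0 < s i.
  apply: contrapT => /forallNP ns; have := oner_neq0 R; rewrite -s1 big1 ?eqxx //.
  by move=> i _; apply/eqP; rewrite eq_le s0 andbT leNgt; apply/negP; exact: ns.
rewrite (bigD1 i) //= [ltRHS](bigD1 i) //= ltr_leD //; first by rewrite ltr_pM2l.
by apply: ler_sum => k _; rewrite ler_wpM2l // ltW.
Qed.

(** An ultrafilter on the closure must contain one of the finitely many balls given by [hull_net],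
    at every radius. It is thus Cauchy and converges by completeness. *)
Lemma compact_closure_hull (R : realType) (X : completeNormedModType R) (V : set X) :
  compact V -> compact (closure (hull V)).
Proof.
move=> Vc; rewrite compact_ultra => F FU FH.
have FF : ProperFilter F by exact: ultra_proper.
have Fc : cauchy F.
  apply/cauchyP => e e0; have e20 : 0 < e / 2 by rewrite divr_gt0.
  have [N [p pnet]] := hull_net Vc e20.
  apply: contrapT => /forallNP nF.
  have FC : F [set a | forall k, (~` ball (p k) e) a].
    apply: filter_forall => k.
    by have [/nF|] := in_ultra_setVsetC (ball (p k) e) FU.
  have [a [aH aC]] := filter_ex (filterI FH FC).
  have [b [bH ab]] := aH (ball a (e / 2)) (nbhsx_ballx _ _ e20).
  have [k bk] := pnet _ bH; apply: (aC k) => //.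
  move: ab; rewrite -!ball_normE /= => ab.
  rewrite distrC (splitr e); apply: le_lt_trans (ler_distD b _ _) _.
  exact: ltrD.
have /cauchy_cvgP Fcvg := Fc.
exists (lim F); split => //; apply: closed_closure => B /Fcvg FB.
have [a [aH aB]] := filter_ex (filterI FH FB).
by exists a.
Qed.

(** * Eigenvectors on the boundary *)

Lemma lincomb_continuous (R : realType) (X : normedModType R) n (b : 'I_n.+1 -> X) :
  continuous (fun r : 'rV[R]_n.+1 => \sum_j r ord0 j *: b j).
Proof.
apply: continuous_sum => j r.
have rj : (x : 'rV[R]_n.+1) ord0 j @[x --> r] --> r ord0 j by exact: coord_continuous.
by have cv := cvgZ rj (cvg_cst (b j)); exact: cv.
Qed.

(* A combination [sum_j r_j b_j] is written [tau *: a] with [a] in the hull of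
   [V] and the slack coordinate [r_0] measuring how far [tau] is from its
   maximal value. *)
Lemma approx_eigenvector (R : realType) (X : normedModType R) (V B D : set X)
    (S : X -> X) (delta rho e : R) (v0 : X) :
  compact V -> V v0 -> 0 < delta ->
  (forall n (s : 'I_n -> R) (v : 'I_n -> X), (forall i, 0 <= s i) ->
     (forall i, V (v i)) -> delta * \sum_i s i <= `|\sum_i s i *: v i|) ->
  closed B -> open D -> D 0 ->
  (forall n (s : 'I_n -> R) (v : 'I_n -> X), (forall i, 0 <= s i) ->
     (forall i, V (v i)) -> D (\sum_i s i *: v i) -> B (\sum_i s i *: v i)) ->
  (forall z, B z -> `|z| <= rho) -> (forall z, B z -> ~ D z -> V (S z)) ->
  0 < e ->
  exists (a : X) (tau : R),
  [/\ hull V a, 0 <= tau <= (rho + 1) / delta, B (tau *: a), ~ D (tau *: a) &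
      exists n (s : 'I_n -> R) (p : 'I_n -> X),
      [/\ forall i, 0 <= s i, \sum_i s i = 1,
          forall i, B (p i) /\ `|tau *: a - p i| < e + e &
          `|a - \sum_i s i *: S (p i)| <= e]].
Proof.
move=> Vc Vv0 delta0 Vdelta Bcl Dop D0 DB Brho BV e0.
have B0 : B 0.
  have := DB 0%N (fun=> 0) (fun=> 0); rewrite !big_ord0; apply => //.
  by case.
have rho0 : 0 <= rho by rewrite -(normr0 X) Brho.
(* Weight [M] forces norm at least [rho + 1], hence leaves [B]. *)
pose M := (rho + 1) / delta; have M0 : 0 < M by rewrite divr_gt0 // ltr_wpDl.
have [[|n] [b [bV bnet]]] := compact_net Vc e0; first by have [[]] := bnet _ Vv0.
pose b' (i : 'I_n.+2) : X := if unlift ord0 i is Some j then M *: b j else 0.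
pose z (r : 'rV[R]_n.+2) : X := \sum_i r ord0 i *: b' i.
have zE r : z r = M *: \sum_j r ord0 (lift ord0 j) *: b j.
  rewrite /z big_ord_recl /b' unlift_none scaler0 add0r scaler_sumr.
  by apply: eq_bigr => j _; rewrite liftK !scalerA mulrC.
have zE' r : z r = \sum_j (M * r ord0 (lift ord0 j)) *: b j.
  by rewrite zE scaler_sumr; apply: eq_bigr => j _; rewrite scalerA.
pose c := \sum_i `|b' i|; have c0 : 0 <= c by apply: sumr_ge0.
pose eta := e / (c + 1); have eta0 : 0 < eta by rewrite divr_gt0 // ltr_wpDl.
have zdist r r' : `|r - r'| < eta -> `|z r - z r'| < e.
  move=> rr; apply: le_lt_trans (lincomb_dist _ _ _) _; rewrite -/c.
  have : `|r - r'| * (c + 1) < e by rewrite -ltr_pdivlMr // ltr_wpDl.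
  by apply: le_lt_trans; rewrite ler_wpM2l // lerDl.
have zcont : continuous z by exact: lincomb_continuous.
(* The index chosen at [r] names a net point close to a value of [S] taken in [B] near [z r]; when
   no such value lies in [V] the index is arbitrary. *)
have near_ex r : exists j,
    (exists p, [/\ B p, `|z r - p| < e & V (S p)]) ->
    exists p, [/\ B p, `|z r - p| < e & `|S p - b j| < e].
  have [[p [Bp zp VSp]]|no] := pselect (exists p, [/\ B p, `|z r - p| < e & V (S p)]).
    by have [j pj] := bnet _ VSp; exists j => _; exists p.
  by exists ord0.
have [g gP] := choice near_ex.
have sum_lift (r : 'rV[R]_n.+2) : simplex r ->
    \sum_j r ord0 (lift ord0 j) = 1 - r ord0 ord0.
  by move=> [_ <-]; rewrite [in RHS]big_ord_recl addrAC subrr add0r.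
have [|||||r [N [w [q [[sr Br nDr] w0 w1 wq rE]]]]] :=
  @simplex_eigenvector R n (z @^-1` B) (z @^-1` (~` D)) g eta _ _ _ _ _ eta0.
- by apply: preimage_closed => // r _; exact: zcont.
- by apply: preimage_closed; [move=> r _; exact: zcont | exact: open_closedC].
- move=> r [r0 _]; have [Dz|] := pselect (D (z r)); [left|by right].
  move: Dz; rewrite /preimage /= zE'; apply: DB => // j.
  by rewrite mulr_ge0 // ltW.
- move=> r sr r00 /Brho; apply/negP; rewrite -ltNge zE normrZ gtr0_norm //.
  rewrite mulrC -ltr_pdivrMr //; apply: lt_le_trans (Vdelta _ _ _ _ _) => //.
    rewrite sum_lift // r00 subr0 mulr1 /M invf_div mulrA ltr_pdivrMr ?ltr_wpDl //.
    by rewrite mulrC ltr_pM2l // ltrDl.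
  by case: sr.
- move=> r sr r01; rewrite /preimage /=; suff -> : z r = 0 by [].
  rewrite zE big1 ?scaler0 // => j _.
  have : \sum_j r ord0 (lift ord0 j) = 0 by rewrite sum_lift // r01 subrr.
  by move=> /psumr_eq0P -> //; [rewrite scale0r | case: sr].
pose a := \sum_k w k *: b (g (q k)); pose tau := M * (1 - r ord0 ord0).
have zr : z r = tau *: a.
  rewrite zE /tau -scalerA; congr (_ *: _).
  rewrite /a (partition_big (g \o q) predT) //= scaler_sumr.
  apply: eq_bigr => j _; rewrite rE -scalerA scaler_suml; congr (_ *: _).
  by apply: eq_bigr => k /eqP ->.
have t0 : 0 <= 1 - r ord0 ord0 by rewrite subr_ge0 simplex_le1.
exists a, tau; rewrite -zr; split => //.
- by exists N, w, (b \o g \o q); split => // k; exact: bV.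
- apply/andP; split; first by rewrite mulr_ge0 // ltW.
  by rewrite -/M -[X in _ <= X]mulr1 ler_pM2l // lerBlDr lerDl; case: sr.
(* For a positive weight, [z r] itself shows that a point [p] near [z (q k)] exists; one [e] leads
   from [z r] to [z (q k)], the other to [p]. For a zero weight [z r] is a placeholder. *)
have pex k : exists p, [/\ B p, `|z r - p| < e + e &
    0 < w k -> `|S p - b (g (q k))| < e].
  have [wk|] := ltP 0 (w k); last first.
    by exists (z r); split => //; rewrite subrr normr0 addr_gt0.
  have rq := zdist _ _ (wq k wk).
  have [|p [Bp zp Sp]] := gP (q k).
    by exists (z r); split => //; [rewrite distrC | exact: BV].
  exists p; split => //; apply: le_lt_trans (ler_distD (z (q k)) _ _) _.
  exact: ltrD.
have [p pP] := choice pex.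
exists N, w, p; split => // [i|]; first by have [] := pP i.
rewrite /a -sumrB; apply: le_trans (ler_norm_sum _ _ _) _.
have <- : \sum_k w k * e = e by rewrite -mulr_suml w1 mul1r.
apply: ler_sum => k _; rewrite -scalerBr normrZ ger0_norm //.
have [wk|wk] := ltP 0 (w k); last first.
  have -> : w k = 0 by apply/eqP; rewrite eq_le wk w0.
  by rewrite !mul0r.
by rewrite ler_wpM2l // distrC ltW //; have [_ _ ->] := pP k.
Qed.

Lemma convex_sum (R : realType) (X : normedModType R) (C : set X) n
    (s : 'I_n -> R) (v : 'I_n -> X) :
  is_convex C -> (forall i, 0 <= s i) -> \sum_i s i = 1 -> (forall i, C (v i)) ->
  C (\sum_i s i *: v i).
Proof.
move=> Cconv; elim: n s v => [|n IH] s v s0.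
  by rewrite big_ord0 => /eqP; rewrite eq_sym oner_eq0.
rewrite !big_ord_recl => s1 Cv; set t := \sum_(i < n) _ in s1.
have t0 : 0 <= t by apply: sumr_ge0.
have tE : t = 1 - s ord0 by rewrite -s1 addrAC subrr add0r.
have s01 : s ord0 <= 1 by rewrite -s1 lerDl.
have [tz|tz] := eqVneq t 0.
  rewrite big1 => [|i _]; last by rewrite (psumr_eq0P _ tz) ?scale0r.
  have -> : s ord0 = 1 by rewrite -s1 tz addr0.
  by rewrite addr0 scale1r.
have -> : \sum_(i < n) s (lift ord0 i) *: v (lift ord0 i) =
    (1 - s ord0) *: \sum_(i < n) (s (lift ord0 i) / t) *: v (lift ord0 i).
  rewrite -tE scaler_sumr; apply: eq_bigr => i _.
  by rewrite scalerA mulrCA divff ?mulr1.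
apply: Cconv => //; apply: IH => [i||i] //; first by rewrite divr_ge0.
by rewrite -mulr_suml divff.
Qed.

(** Take a cluster point of the approximate pairs for [e = 1 / k.+1], whose vectors lie in the
    compact closed hull of [V] and whose weights lie in [[0, M]]. Each closed convex [C] in the
    definition of the envelope contains convex combinations arbitrarily close to [a]. *)
Lemma envelope_eigenvector (R : realType) (X : completeNormedModType R)
    (V B D : set X) (S : X -> X) (delta rho : R) (v0 : X) :
  compact V -> V v0 -> 0 < delta ->
  (forall n (s : 'I_n -> R) (v : 'I_n -> X), (forall i, 0 <= s i) ->
     (forall i, V (v i)) -> delta * \sum_i s i <= `|\sum_i s i *: v i|) ->
  closed B -> open D -> D 0 ->
  (forall n (s : 'I_n -> R) (v : 'I_n -> X), (forall i, 0 <= s i) ->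
     (forall i, V (v i)) -> D (\sum_i s i *: v i) -> B (\sum_i s i *: v i)) ->
  (forall z, B z -> `|z| <= rho) -> (forall z, B z -> ~ D z -> V (S z)) ->
  exists (a : X) (tau : R),
  [/\ 0 <= tau, B (tau *: a), ~ D (tau *: a) & ccenv B S (tau *: a) a].
Proof.
move=> Vc Vv0 delta0 Vdelta Bcl Dop D0 DB Brho BV.
pose M := (rho + 1) / delta.
have step k := @approx_eigenvector R X V B D S delta rho k.+1%:R^-1 v0 Vc Vv0
  delta0 Vdelta Bcl Dop D0 DB Brho BV (ltac:(by rewrite invr_gt0 ltr0n)).
have [a_ /choice[t_ atP]] := choice step.
have [|[a tau] [/= _ tauM] clat] := @compact_seq_cluster R (X * R)%type
    (closure (hull V) `*` [set` `[0, M]]) (fun k => (a_ k, t_ k))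
    (compact_setX (compact_closure_hull Vc) (@segment_compact _ _ _)).
  move=> k; have [Ha tM _ _ _] := atP k; split; first exact: subset_closure.
  by rewrite /= in_itv.
have /andP[tau0 tauleM] : 0 <= tau <= M by move: tauM; rewrite /= in_itv.
have M0 : 0 <= M := le_trans tau0 tauleM.
pose z := tau *: a.
have near (e : R) : 0 < e -> exists k,
    [/\ k.+1%:R^-1 < e, `|a - a_ k| < e & `|z - t_ k *: a_ k| < e].
  (* The error of the product is at most [d * (|a| + M)]; the extra [1] makes it less than [e] and
     gives [d <= e]. *)
  move=> e0; pose d := e / (`|a| + M + 1).
  have N0 : 0 < `|a| + M + 1 by rewrite ltr_wpDl // addr_ge0.
  have d0 : 0 < d by rewrite divr_gt0.
  have de : d <= e by rewrite ler_pdivrMr // ler_peMr ?lerDr ?addr_ge0 // ltW.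
  have [k kk] := clat d d0 (Num.truncn e^-1).
  rewrite prod_normE /= gt_max => /andP[ak tk]; exists k; split.
  - rewrite invf_plt ?posrE ?ltr0n //.
    by apply: lt_le_trans (truncnS_gt _) _; rewrite ler_nat ltnS.
  - exact: lt_le_trans ak de.
  have [_ /andP[tk0 tkM] _ _ _] := atP k.
  apply: le_lt_trans (ler_distD (t_ k *: a) _ _) _.
  rewrite -scalerBl -scalerBr !normrZ (ger0_norm tk0).
  have h1 : `|tau - t_ k| * `|a| <= d * `|a| by rewrite ler_wpM2r // ltW.
  have h2 : t_ k * `|a - a_ k| <= M * d by apply: ler_pM => //; exact: ltW.
  have h3 : d * (`|a| + M + 1) = e by rewrite divfK // gt_eqF.
  by rewrite -h3 !mulrDr mulr1 [d * M]mulrC; lra.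
have Bz : B z.
  apply: closed_approx => // e e0; have [k [_ _ zk]] := near e e0.
  by exists (t_ k *: a_ k) => //; have [] := atP k.
have nDz : ~ D z.
  have : closed (~` D) by exact: open_closedC.
  move=> Dcl; apply: (closed_approx Dcl) => e e0; have [k [_ _ zk]] := near e e0.
  by exists (t_ k *: a_ k) => //; have [] := atP k.
exists a, tau; split => // e e0 C Ccl Cconv SC; apply: closed_approx => // th th0.
have e30 : 0 < e / 3 by rewrite divr_gt0.
have th20 : 0 < th / 2 by rewrite divr_gt0.
(* From [z] to [p i] there are three errors below [e / 3], and from [a] to the combination two below
   [th / 2]. *)
have [|k [kd ak zk]] := near (Num.min (e / 3) (th / 2)).
  by rewrite lt_min e30 th20.
move: kd ak zk; rewrite !lt_min => /andP[ke kth] /andP[_ ath] /andP[ze _].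
have [_ _ _ _ [n [s [p [s0 s1 pB aS]]]]] := atP k.
move: ke kth aS pB; move: (k.+1%:R^-1) => x ke kth aS pB.
exists (\sum_i s i *: S (p i)).
  apply: convex_sum => // i; apply: SC; exists (p i) => //.
  have [Bp pz] := pB i; split => //; rewrite /cball /= -/z distrC.
  by apply: le_trans (ler_distD (t_ k *: a_ k) _ _) _; lra.
by apply: le_lt_trans (ler_distD (a_ k) _ _) _; lra.
Qed.

(** * Translation by [y] and the fixed point *)

Lemma translateP (R : realType) (X : normedModType R) (y z : X) (A : set X) :
  translate y A (y + z) <-> A z.
Proof. by split=> [[a Aa /addrI <-]|Az] //; exists z. Qed.

Lemma closure_sub_closed (T : topologicalType) (A C : set T) :
  closed C -> A `<=` C -> closure A `<=` C.
Proof. by move=> Ccl AC x /(closureS AC); rewrite -(closure_id C).1. Qed.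

Lemma closureP_norm (R : realType) (X : normedModType R) (A : set X) (x : X) :
  closure A x <-> forall e : R, 0 < e -> exists2 z, A z & `|x - z| < e.
Proof.
split=> [clx e e0|H].
  have [z [Az]] := clx _ (nbhsx_ballx x e e0).
  by rewrite -ball_normE /=; exists z.
apply: closed_approx; first exact: closed_closure.
by move=> e /H[z Az xz]; exists z => //; exact: subset_closure.
Qed.

Lemma inf_norm_le (R : realType) (X : normedModType R) (A : set X) v :
  A v -> inf [set `|v| | v in A] <= `|v|.
Proof.
by move=> Av; apply: ge_inf; [exists 0 => _ [w _ <-] | exists v].
Qed.

Theorem theorem2p13 (R : realType) (X : completeNormedModType R)
  (K : set X) (c : R) (D : set X) (y : X) (T : X -> X) (lambda_bar : R) :
  is_cone K -> normal_cone K c ->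
  open D -> bounded_set D -> D 0 ->
  let Ky := translate y K in
  let DKy := translate y D `&` Ky in
  let DKy_bar := rel_closure Ky DKy in
  let dDKy := rel_boundary Ky DKy in
  let m := inf [set `|v| | v in [set v | exists2 x, dDKy x & ccenv DKy_bar T x v]] in
  (forall x, DKy_bar x -> K (T x)) ->
  compact (closure (T @` DKy_bar)) ->
  0 < m ->
  c * sup [set `|x| | x in boundary D] / m < lambda_bar ->
  (forall lambda : R, 0 < lambda -> lambda <= lambda_bar ->
     forall x, DKy_bar x ->
       ccenv DKy_bar (fun z => y + lambda *: T z) x x ->
       x = y + lambda *: T x) ->
  exists x_star lambda_star,
    [/\ dDKy x_star, 0 < lambda_star, lambda_star < lambda_bar &
        x_star = y + lambda_star *: T x_star].
Proof.
move=> Kcone Knormal Dop Dbd D0 Ky DKy bar bd m TK Tc m0 lam_gt Tfix.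
have [Kcl Kconv Kscale _] := Kcone; have [c0 Knorm] := Knormal.
(* Moving [y] to the origin replaces the translated cone by [K] itself. *)
pose B := [set z | bar (y + z)].
have barE z : B z <-> K z /\ forall e : R, 0 < e -> exists2 d, D d & K d /\ `|z - d| < e.
  split=> [[/translateP Kz zD]|[Kz zD]]; split=> //.
  - move=> e /zD[_ [_ [[d Dd <-] /translateP Kd]]].
    by rewrite opprD addrACA subrr add0r; exists d.
  - exact/translateP.
  - move=> e /zD[d Dd [Kd zd]]; exists (y + d); split.
    + exact/translateP.
    + by split; exact/translateP.
    + by rewrite opprD addrACA subrr add0r.
have BK z : B z -> K z by move=> /barE[].
have DB z : D z -> K z -> B z.
  move=> Dz Kz; apply/barE; split=> // e e0.
  by exists z => //; rewrite subrr normr0.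
have Bcl : closed B.
  move=> z /closureP_norm clz; apply/barE; split.
    by apply: closed_approx => // e /clz[w /BK Kw zw]; exists w.
  move=> e e0; have e20 : 0 < e / 2 by rewrite divr_gt0.
  have [w /barE[_ /(_ _ e20)[d Dd [Kd wd]]] zw] := clz _ e20.
  exists d => //; split=> //; apply: le_lt_trans (ler_distD w _ _) _.
  by rewrite (splitr e) ltrD.
have bdP z : B z -> ~ D z -> bd (y + z).
  move=> Bz nDz; split=> //; have Kz := BK _ Bz; split; first exact/translateP.
  move=> e e0; exists (y + z); split; first exact/translateP.
  - split; first exact/translateP.
    by case=> /translateP.
  - by rewrite subrr normr0.
have ccT x : bar x -> ccenv bar T x (T x).
  move=> barx e e0 C _ _; apply; exists x => //; split => //.
  by rewrite /cball /= subrr normr0 ltW.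
have m_le x v : bd x -> ccenv bar T x v -> m <= `|v|.
  by move=> bdx xv; apply: inf_norm_le; exists x.
(* The infimum of the empty set is [0], so [0 < m] forces the relative boundary to be nonempty. *)
have [x1 bdx1] : exists x, bd x.
  apply: contrapT => /forallNP nobd; move: m0; rewrite /m.
  suff -> : [set v | exists2 x, bd x & ccenv bar T x v] = set0.
    by rewrite image_set0 inf0 ltxx.
  by rewrite -subset0 => v [x /nobd].
pose V := closure (T @` bar) `&` [set v | m <= `|v|].
have TV x : bd x -> V (T x).
  move=> bdx; have barx : bar x by case: bdx.
  split; first by apply: subset_closure; exists x.
  exact: m_le (ccT _ barx).
have Vc : compact V.
  apply: compact_closedI => //.
  apply: (@preimage_closed _ _ (fun v : X => `|v|) [set t : R | m <= t]).
    by move=> v _; exact: norm_continuous.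
  exact: closed_ge.
have VK : V `<=` K.
  by move=> v [+ _]; apply: closure_sub_closed => // _ [x barx <-]; exact: TK.
have [delta delta0 Vdelta] : exists2 delta : R, 0 < delta &
    forall n (s : 'I_n -> R) (v : 'I_n -> X), (forall i, 0 <= s i) ->
    (forall i, V (v i)) -> delta * \sum_i s i <= `|\sum_i s i *: v i|.
  by apply: (cone_hull_norm_ge Kcone Knormal Vc VK m0) => v [].
have [rho Drho] : exists rho : R, forall d, D d -> `|d| <= rho.
  by case: Dbd => r [_ Dr]; exists (r + 1) => d; apply: Dr; rewrite ltrDl.
have Brho z : B z -> `|z| <= rho.
  move=> /barE[_ zD]; apply/ler_addgt0Pr => e /zD[d Dd [_ zd]].
  rewrite -(subrK d z) addrC; apply: le_trans (ler_normD _ _) _.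
  by rewrite lerD ?Drho // ltW.
have K0 : K 0.
  by rewrite -(scale0r (T x1)); apply: Kscale => //; apply: TK; case: bdx1.
have [||a [tau [tau0 Bz nDz za]]] := envelope_eigenvector (S := fun z => T (y + z))
  Vc (TV _ bdx1) delta0 Vdelta Bcl Dop D0 _ Brho.
- move=> n s v s0 vV Dsv; apply: DB => //; apply: cone_sum => // i _.
  by apply: Kscale => //; exact: VK.
- by move=> z Bz nDz; apply: TV; exact: bdP.
set z := tau *: a in Bz nDz za.
have xa : ccenv bar T (y + z) a.
  move=> e e0 C Ccl Cconv TC; apply: (za e e0 C Ccl Cconv) => _ [w [zw Bw] <-].
  apply: TC; exists (y + w) => //; split => //.
  by rewrite /cball /= opprD addrACA subrr add0r.
have bdx := bdP _ Bz nDz; have ma := m_le _ _ bdx xa.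
have a0 : 0 < `|a| := lt_le_trans m0 ma.
have Ka : K a.
  by apply: (xa 1 ltr01) => // _ [w [_ barw] <-]; exact: TK.
(* Normality applied to [a] below itself, with [a] nonzero. *)
have c1 : 1 <= c.
  rewrite -(ler_pM2r a0) mul1r; apply: Knorm; rewrite /cone_le ?subr0 //.
  by rewrite subrr.
have z_le : `|z| <= sup [set `|x| | x in boundary D].
  apply: ub_le_sup; last first.
    exists z => //; split; last exact: subset_closure.
    by apply/closureP_norm => e /((barE z).1 Bz).2[d Dd [_ zd]]; exists d.
  exists rho => _ [w [+ _] <-] => /closureP_norm clw.
  apply/ler_addgt0Pr => e /clw[d Dd wd].
  rewrite -(subrK d w) addrC; apply: le_trans (ler_normD _ _) _.
  by rewrite lerD ?Drho // ltW.
have tau_gt0 : 0 < tau.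
  rewrite lt_def tau0 andbT; apply/eqP => tauz.
  by apply: nDz; rewrite /z tauz scale0r.
(* Here [tau * m <= tau * |a| = |z|], and [|z|] is at most the supremum, hence at most [c] times
   it. *)
have tau_lt : tau < lambda_bar.
  apply: le_lt_trans lam_gt; rewrite ler_pdivlMr //.
  apply: (@le_trans _ _ `|z|); first by rewrite normrZ ger0_norm // ler_wpM2l.
  by apply: (le_trans z_le); rewrite ler_peMl // (le_trans _ z_le).
exists (y + z), tau; split => //.
(* The affine map [v |-> y + tau *: v] pulls closed convex sets back to closed convex sets, so it
   carries [a] from the envelope of [T] to [y + z] in the envelope of [y + tau T]. *)
apply: Tfix => //; first exact: ltW.
move=> e e0 C Ccl Cconv TC.
apply: (xa e e0 [set v | C (y + tau *: v)]).
- apply: (@preimage_closed _ _ (fun v : X => y + tau *: v) C) => // v _.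
  have idv : x @[x --> v] --> v by exact: cvg_id.
  by have cv := cvgD (cvg_cst y) (cvgZ (cvg_cst tau) idv); exact: cv.
- move=> u v t t0 t1 Cu Cv /=.
  have := Cconv _ _ t t0 t1 Cu Cv; congr C.
  have tt : t + (1 - t) = 1 by rewrite addrC subrK.
  rewrite !scalerDr !scalerA addrACA -scalerDl tt scale1r.
  by rewrite [t * tau]mulrC [(1 - t) * tau]mulrC.
- by move=> _ [w wP <-]; apply: TC; exists w.
Qed.
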